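(* Let $N\subset M$ be a finite index inclusion of type $\mathrm{II}_1$ factors (not necessarily irreducible) and let $P,Q$ be intermediate subfactors of $N\subset M$, both different from $N$. Then the quadruple $(N,P,Q,M)$ is a commuting square if and only if $\alpha^N_M(P,Q)=\frac{\pi}{2}$.
   Context: $E^M_A$ denotes the trace-preserving conditional expectation of $M$ onto $A\subseteq M$. The quadruple $(N,P,Q,M)$ with $N\subseteq P,Q\subseteq M$ is a commuting square if $E^M_PE^M_Q=E^M_QE^M_P=E^M_N$. $M_1=\langle M,e_1\rangle$ is the Jones basic construction of $N\subset M$ on $L^2(M)$, $e_1$ being the orthogonal projection of $L^2(M)$ onto $L^2(N)$, and $tr$ is the normalized trace of $M_1$. $e_P\in N'\cap M_1$ is the orthogonal projection of $L^2(M)$ onto $L^2(P)$. For $P\neq N$ put $v_P=\frac{e_P-e_1}{\|e_P-e_1\|_2}$, where $\langle x,y\rangle=tr(y^*x)$ and $\|x\|_2=tr(x^*x)^{1/2}$. For $P,Q\ne N$ the angle is $\alpha^N_M(P,Q)=\cos^{-1}\langle v_P,v_Q\rangle$. *)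

(* Defs.v *)
From HB Require Import structures.
From mathcomp Require Import all_boot all_order all_algebra.
From mathcomp Require Import all_classical all_reals all_analysis.
From mathcomp Require Import complex.

Set Implicit Arguments.
Unset Strict Implicit.
Unset Printing Implicit Defensive.

Import Order.TTheory GRing.Theory Num.Theory.
Import numFieldNormedType.Exports.

Local Open Scope classical_set_scope.
Local Open Scope ring_scope.
Local Open Scope complex_scope.

(* [inner] is linear in its first argument and conjugate-linear in its second. *)
Structure hilbert (R : realType) := Hilbert {
  hspace :> completeNormedModType R[i];
  inner : {dot hspace for (@Num.conj R[i])};
  inner_norm : forall x : hspace, `|x| ^+ 2 = inner x x
}.

Section operators.
Context {R : realType} {H : hilbert R}.
Implicit Types (T S x y p q : H -> H) (A : set (H -> H)) (V : set H).

Definition bounded_op : set (H -> H) := [set T | linear T /\ continuous T].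

(* Every bounded operator has a unique adjoint (Riesz), so the default value 0
   is never used on [bounded_op]. *)
Definition adj T : H -> H :=
  xget (0 : H -> H) [set S | bounded_op S /\
    forall u v : H, inner H (T u) v = inner H u (S v)].

Definition positive_op T := forall u : H, 0 <= inner H (T u) u.

(* The orthogonal projection onto a closed linear subspace V. *)
Definition orth_proj V (u : H) : H :=
  xget 0 [set v | V v /\ forall w, V w -> inner H (u - v) w = 0].

Definition commutant A : set (H -> H) :=
  [set T | bounded_op T /\ forall S, A S -> T \o S = S \o T].

Definition von_neumann_algebra A :=
  [/\ A `<=` bounded_op,
      forall T, A T -> A (adj T) &
      commutant (commutant A) = A].

Definition is_factor A :=
  [/\ von_neumann_algebra A, (id : H -> H) <> 0 &
      A `&` commutant A = [set T | exists c : R[i], T = c *: (id : H -> H)]].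

Definition finite_vna A :=
  forall v, A v -> adj v \o v = id -> v \o adj v = id.

Definition projection_of A p := [/\ A p, p \o p = p & adj p = p].

Definition minimal_projection_of A p :=
  [/\ projection_of A p, p <> 0 &
      forall q, projection_of A q -> p \o q = q -> q = 0 \/ q = p].

(* A factor is of type I iff it has a minimal projection, so these are the
   finite factors that are not of type I. *)
Definition II1_factor A :=
  [/\ is_factor A, finite_vna A & ~ exists p, minimal_projection_of A p].

(* [t] is only constrained on A. On a finite factor it is unique there, and
   normality is automatic. *)
Definition normalized_trace A (t : (H -> H) -> R[i]) :=
  [/\ forall (c : R[i]) x y, A x -> A y -> t (c *: x + y) = c * t x + t y,
      forall x, A x -> 0 <= t (adj x \o x),
      forall x, A x -> t (adj x \o x) = 0 -> x = 0,
      t id = 1 &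
      forall x y, A x -> A y -> t (x \o y) = t (y \o x)].

(* E is the t-preserving conditional expectation of A onto B; it is unique as
   a map on A. *)
Definition conditional_expectation A (t : (H -> H) -> R[i]) (B : set (H -> H))
    (E : (H -> H) -> (H -> H)) :=
  [/\ (forall x, A x -> B (E x)) /\ (forall b, B b -> E b = b),
      forall (c : R[i]) x y, A x -> A y -> E (c *: x + y) = c *: E x + E y,
      forall x, A x -> positive_op (E (adj x \o x)),
      forall a x b, B a -> A x -> B b -> E (a \o x \o b) = a \o E x \o b &
      forall x, A x -> t (E x) = t x].

Definition commuting_square (M : set (H -> H)) (EN EP EQ : (H -> H) -> (H -> H)) :=
  forall x, M x -> EP (EQ x) = EN x /\ EQ (EP x) = EN x.

(* Murray and von Neumann's coupling constant of a factor A on H: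
   dim_A(H) = tr_A([A' u]) / tr_A'([A u]), which does not depend on u <> 0; it
   is infinite exactly when A' has no normalized trace. *)
Definition coupling_constant A (d : R) :=
  exists (t t' : (H -> H) -> R[i]) (u : H),
    [/\ normalized_trace A t, normalized_trace (commutant A) t', u <> 0 &
        t (orth_proj (closure [set T u | T in commutant A])) /
        t' (orth_proj (closure [set T u | T in A])) = d%:C].

Definition tr_inner (t : (H -> H) -> R[i]) x y : R[i] := t (adj y \o x).

Definition tr_norm (t : (H -> H) -> R[i]) x : R := Num.sqrt (complex.Re (t (adj x \o x))).

End operators.

Section basic_construction.
Context {R : realType} {H L : hilbert R}.
Variables (M : set (H -> H)) (tau : (H -> H) -> R[i]).
Implicit Types (N P Q : set (H -> H)) (j : (H -> H) -> L).

(* L, with j : M -> L, is the completion L^2(M) of M for <x, y> = tau (y^* x). *)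
Definition L2_space j :=
  [/\ forall (c : R[i]) x y, M x -> M y -> j (c *: x + y) = c *: j x + j y,
      forall x y, M x -> M y -> inner L (j x) (j y) = tau (adj y \o x) &
      closure (j @` M) = setT].

(* M acts on L^2(M) by left multiplication. *)
Definition left_action j (lam : (H -> H) -> (L -> L)) :=
  forall x, M x ->
    bounded_op (lam x) /\ forall y, M y -> lam x (j y) = j (x \o y).

(* The orthogonal projection of L^2(M) onto L^2(P); it is e_1 for P = N. *)
Definition jones_proj j P : L -> L := orth_proj (closure (j @` P)).

(* [M : N] = dim_N(L^2(M)). *)
Definition jones_index (lam : (H -> H) -> (L -> L)) N (d : R) :=
  coupling_constant (lam @` N) d.

Definition finite_index (lam : (H -> H) -> (L -> L)) N :=
  exists d : R, jones_index lam N d.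

(* The von Neumann algebra on L^2(M) generated by M and e_1. *)
Definition basic_construction j (lam : (H -> H) -> (L -> L)) N : set (L -> L) :=
  commutant (commutant (lam @` M `|` [set jones_proj j N])).

Definition unit_vec j (tr : (L -> L) -> R[i]) N P : L -> L :=
  let x := jones_proj j P - jones_proj j N in (tr_norm tr x)^-1%:C *: x.

(* The inner product below is real, tr being a trace and e_P, e_Q projections
   above e_1; [complex.Re] only changes its type. *)
Definition angle j (tr : (L -> L) -> R[i]) N P Q : R :=
  acos (complex.Re (tr_inner tr (unit_vec j tr N P) (unit_vec j tr N Q))).

End basic_construction.

(* Main.v *)
(* e_P extends the conditional expectation E_P, so the quadruple is a commuting
   square iff e_Q e_P = e_1, that is, iff the projections p = e_P - e_1 and
   q = e_Q - e_1 satisfy qp = 0. As tr (qp) = tr ((qp)^* (qp)) and tr is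
   faithful, this means tr (qp) = 0, i.e. a right angle, once e_P and e_Q are
   known to lie in M_1. An operator T in the commutant of M and e_1 is
   determined by the vector T 1 of L^2(N), whence T and its adjoint preserve
   L^2(P) and T commutes with e_P. *)
Require Import Defs.
From mathcomp Require Import all_boot all_order all_algebra.
From mathcomp Require Import all_classical all_reals all_analysis.
From mathcomp Require Import complex ring.
Set Implicit Arguments.
Unset Strict Implicit.

Import Order.TTheory GRing.Theory Num.Theory.
Import numFieldNormedType.Exports.
Local Open Scope classical_set_scope.
Local Open Scope ring_scope.
Local Open Scope complex_scope.

(** * Density arguments: limits along filters and extension from a dense set *)

Section topology.

(** The filter generated by the sets [D] ∩ [f^-1 U], for [U] a neighbourhood of [x], is proper
    because [x] is in the closure. It lives on the index type, so that other functions of the index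
    can be followed along it. *)
Lemma closure_image_cvg {I : Type} {T : topologicalType} (D : set I)
    (f : I -> T) x : closure (f @` D) x ->
  exists F : set_system I, [/\ ProperFilter F, F D & f @ F --> x].
Proof.
move=> Dx; exists (filter_from (nbhs x) (fun U => D `&` f @^-1` U)); split.
- apply: filter_from_proper; first apply: filter_from_filter.
  + by exists setT; exact: filterT.
  + move=> U W xU xW; exists (U `&` W); first exact: filterI.
    by move=> i [Di [Ui Wi]]; split; split.
  + by move=> U /Dx [_ [[i Di <-] Ui]]; exists i.
- by exists setT; [exact: filterT|move=> i []].
- by move=> U xU; exists U => // i [].
Qed.

Lemma closure_min {T : topologicalType} (A B : set T) :
  closed B -> A `<=` B -> closure A `<=` B.
Proof. by move=> cB AB; rewrite closureE => x; apply. Qed.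

Lemma closure_preimage {T U : topologicalType} (f : T -> U) (A : set T)
    (B : set U) : continuous f -> (forall x, A x -> closure B (f x)) ->
  forall x, closure A x -> closure B (f x).
Proof.
move=> fc AB; apply: closure_min => //.
by move/continuous_closedP : fc; apply; exact: closed_closure.
Qed.

Lemma eq_on_closure {K : numFieldType} {T : topologicalType}
    {V : normedModType K} (f g : T -> V) (A : set T) :
  continuous f -> continuous g -> (forall x, A x -> f x = g x) ->
  forall x, closure A x -> f x = g x.
Proof.
move=> fc gc AB; apply: closure_min => //.
have -> : (fun x => f x = g x) = (fun x => f x - g x) @^-1` [set 0].
  apply/seteqP; split=> x /=; first by move=> ->; rewrite subrr.
  by move/eqP; rewrite subr_eq0 => /eqP.
apply: preimage_closed; first by move=> x _; apply: cvgB; [exact: fc|exact: gc].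
apply: accessible_closed_set1; apply: hausdorff_accessible.
exact: norm_hausdorff.
Qed.

(** The values of [g] are Cauchy along [F] because those of [f] are, and [W] is complete. *)
Lemma cvg_contraction {K : numFieldType} {I : Type} {V : normedModType K}
    {W : completeNormedModType K} (F : set_system I) (D : set I) (f : I -> V)
    (g : I -> W) (x : V) : ProperFilter F -> F D ->
  (forall i k, D i -> D k -> `|g i - g k| <= `|f i - f k|) ->
  f @ F --> x -> cvg (g @ F).
Proof.
move=> FF FD fg fx; apply/cauchy_cvgP; apply: cauchy_exP => e e0.
have Fi : \forall i \near F, D i /\ `|x - f i| < e / 2.
  apply: filterI => //; move/cvgrPdist_lt : fx; apply.
  by rewrite divr_gt0.
have [k [Dk xk]] := filter_ex Fi.
exists (g k); apply: filterS Fi => i [Di xi]; rewrite /= -ball_normE /=.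
apply: (le_lt_trans (fg _ _ Dk Di)); rewrite (splitr e).
apply: le_lt_trans (ltrD xk xi).
by rewrite [`|x - f k|]distrC ler_distD.
Qed.

End topology.

(** * Inner products, Cauchy-Schwarz and uniqueness of adjoints *)

Section hilbert.
Context {R : realType} {H : hilbert R}.
Implicit Types (u v w : H) (V : set H) (T S : H -> H).
Local Notation "<[ u , v ]>" := (inner H u v).

Lemma innerC u v : <[u, v]> = (<[v, u]>)^*%C.
Proof. by rewrite hermC expr0 mul1r. Qed.

Lemma innerDl u v w : <[u + v, w]> = <[u, w]> + <[v, w]>.
Proof. exact: linearDl. Qed.
Lemma innerBl u v w : <[u - v, w]> = <[u, w]> - <[v, w]>.
Proof. exact: linearBl. Qed.
Lemma innerZl c u w : <[c *: u, w]> = c * <[u, w]>.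
Proof. by rewrite linearZl_LR. Qed.
Lemma innerBr u v w : <[w, u - v]> = <[w, u]> - <[w, v]>.
Proof. exact: linearBr. Qed.
Lemma innerZr c u w : <[w, c *: u]> = c^*%C * <[w, u]>.
Proof. by rewrite linearZr_LR. Qed.

Lemma innerv_ge0 u : 0 <= <[u, u]>.
Proof. by rewrite -inner_norm exprn_ge0. Qed.

Lemma inner_def u : <[u, u]> = 0 -> u = 0.
Proof. by rewrite -inner_norm => /eqP; rewrite sqrf_eq0 normr_eq0 => /eqP. Qed.

Lemma inner_inj u v : (forall w, <[u, w]> = <[v, w]>) -> u = v.
Proof.
move=> uv; apply/eqP; rewrite -subr_eq0; apply/eqP/inner_def.
by rewrite innerBl uv subrr.
Qed.

Lemma inner_le u v : `|<[u, v]>| <= `|u| * `|v|.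
Proof.
have [->|v0] := eqVneq v 0.
  by rewrite [<[_, _]>]linear0r normr0 normr0 mulr0.
have b0 : 0 < <[v, v]> by rewrite -inner_norm exprn_gt0 // normr_gt0.
rewrite -(ler_sqr (x := `|<[u, v]>|)) ?nnegrE ?mulr_ge0 // exprMn !inner_norm.
(* This vector is <v, v> times the component of [u] orthogonal to [v]; its square norm factors as b
   (c b - |a|^2). *)
have := innerv_ge0 (<[v, v]> *: u - <[u, v]> *: v).
rewrite innerBl !innerBr !innerZl !innerZr (innerC v u) -(innerC v v).
set a := <[u, v]>; set b := <[v, v]>; set c := <[u, u]>.
rewrite (_ : _ - _ = b * (c * b - `|a| ^+ 2)); last first.
  by rewrite normCK; ring.
by rewrite pmulr_rge0 // subr_ge0.
Qed.

Lemma continuous_inner_l v : continuous (fun u => <[u, v]>).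
Proof.
move=> u; apply/cvgrPdist_le => e e0; near=> w.
rewrite -innerBl (le_trans (inner_le _ _)) //.
have v1 : 0 < `|v| + 1 by rewrite ltr_wpDl.
rewrite (@le_trans _ _ (`|u - w| * (`|v| + 1))) ?ler_wpM2l ?lerDl //.
rewrite -ler_pdivlMr //; near: w.
by apply: cvgr_dist_le => //; rewrite divr_gt0.
Unshelve. all: by end_near. Qed.

Lemma continuous_inner_r v : continuous (fun u => <[v, u]>).
Proof.
move=> u; apply/cvgrPdist_le => e e0; near=> w.
rewrite -innerBr innerC norm_conjC; near: w.
have /cvgrPdist_le/(_ e e0) := @continuous_inner_l v u.
by apply: filterS => w; rewrite innerBl.
Unshelve. all: by end_near. Qed.

(** Non-degeneracy of the inner product leaves only one candidate for the choice made in [adj]. *)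
Lemma adj_eq T S : bounded_op S -> (forall u v, <[T u, v]> = <[u, S v]>) ->
  adj T = S.
Proof.
move=> bS TS; rewrite /adj; case: xgetP => [S' _ [_ TS']|/(_ S)]; last first.
  by case; split.
apply/funext => v; apply: inner_inj => u.
by rewrite innerC -TS' TS -innerC.
Qed.

(** * Subspaces and orthogonal projections *)

Definition subspace V := V 0 /\ forall c u v, V u -> V v -> V (c *: u + v).

Lemma subspaceB V u v : subspace V -> V u -> V v -> V (u - v).
Proof. by move=> [_ VZ] Vu Vv; rewrite addrC -scaleN1r; exact: VZ. Qed.

Lemma closure_subspace V : subspace V -> subspace (closure V).
Proof.
move=> [V0 VD]; split; first exact: subset_closure.
move=> c u v Vu Vv.
suff: forall w, V w -> closure V (c *: w + v).
  move=> Vw; apply: (@closure_preimage _ _ (fun w => c *: w + v) V V) Vu => //.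
  by move=> w; apply: cvgD; [apply: cvgZl_tmp|exact: cvg_cst].
move=> w Vw; apply: (@closure_preimage _ _ (fun v => c *: w + v) V V) Vv => //.
  by move=> v'; apply: cvgD => //; exact: cvg_cst.
by move=> v' Vv'; apply: subset_closure; exact: VD.
Qed.

(** The relation from which [orth_proj] chooses. Kept apart, it lets existence be proved by density,
    so that the default value of [orth_proj] is ruled out. *)
Definition is_proj V u v := V v /\ forall w, V w -> <[u - v, w]> = 0.

(** Pythagoras: u - u' is the sum of v - v' and a vector orthogonal to it. *)
Lemma is_proj_le V u u' v v' : subspace V -> is_proj V u v ->
  is_proj V u' v' -> `|v - v'| <= `|u - u'|.
Proof.
move=> sV [Vv uv] [Vv' uv'].
have Vd := subspaceB sV Vv Vv'.
rewrite -(ler_sqr (x := `|v - v'|)) ?nnegrE // !inner_norm.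
have -> : u - u' = ((u - v) - (u' - v')) + (v - v').
  by rewrite opprB [RHS]addrACA subrK [v' - u']addrC addrK.
have uv0 : <[u - v - (u' - v'), v - v']> = 0.
  by rewrite innerBl uv // uv' // subrr.
by rewrite [leRHS](hnormDd uv0) lerDr innerv_ge0.
Qed.

Lemma is_proj_inj V u v v' : subspace V -> is_proj V u v -> is_proj V u v' ->
  v = v'.
Proof.
move=> sV uv uv'; apply/eqP; rewrite -subr_eq0 -normr_le0.
by rewrite (le_trans (is_proj_le sV uv uv')) // subrr normr0.
Qed.

Lemma orth_proj_eq V u v : subspace V -> is_proj V u v -> orth_proj V u = v.
Proof.
move=> sV uv; rewrite /orth_proj; case: xgetP => [v' _|/(_ v) //].
by move/(is_proj_inj sV uv).
Qed.

Lemma is_projP V u v : subspace V -> is_proj V u v ->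
  is_proj V u (orth_proj V u).
Proof. by move=> sV uv; rewrite (orth_proj_eq sV uv). Qed.

(* Projections are contractive, so the points having one form a closed set. *)
Lemma is_proj_closure V (D : set H) : subspace V -> closed V ->
  (forall u, D u -> is_proj V u (orth_proj V u)) ->
  forall u, closure D u -> is_proj V u (orth_proj V u).
Proof.
move=> sV cV DV u; rewrite -[D]image_id => /closure_image_cvg[F [FF FD Fu]].
have /cvg_ex [v Fv] : cvg (orth_proj V @ F).
  apply: (@cvg_contraction R[i] H H H F D id (orth_proj V) u FF FD _ Fu)
    => w w' Dw Dw' /=.
  by apply: (is_proj_le sV); exact: DV.
apply: (@is_projP V u v) => //; split.
  by apply: closed_cvg cV _ _ Fv; apply: filterS FD => w /DV[].
move=> w Vw.
have Fuv : (fun u' => u' - orth_proj V u') @ F --> u - v by exact: cvgB.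
have cw : {for u - v, continuous (fun v => <[v, w]>)}.
  exact: continuous_inner_l.
have : (fun u' => <[u' - orth_proj V u', w]>) @ F --> <[u - v, w]>.
  exact: cvg_comp Fuv cw.
have : (fun u' => <[u' - orth_proj V u', w]>) @ F -->
    (0 : (R[i] : numFieldType)).
  by apply: cvg_near_cst; apply: filterS FD => u' /DV[_ +]; apply.
by move=> h0 h; exact: (cvg_unique (@norm_hausdorff _ _) h h0).
Qed.

Section projection.
Variable V : set H.
Hypotheses (sV : subspace V) (projV : forall u, is_proj V u (orth_proj V u)).
Local Notation e := (orth_proj V).

Lemma orth_proj_in u : V (e u). Proof. by have [] := projV u. Qed.

Lemma orth_proj_id v : V v -> e v = v.
Proof.
move=> Vv; apply: orth_proj_eq => //; split=> // w _.
by rewrite subrr [LHS]linear0l.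
Qed.

Lemma orth_proj_linear : linear e.
Proof.
move=> c u v; apply: orth_proj_eq => //; split.
  by apply: sV.2; exact: orth_proj_in.
move=> w Vw; rewrite opprD addrACA -scalerBr innerDl innerZl.
by rewrite (projV u).2 // (projV v).2 // mulr0 addr0.
Qed.

(** Both sides equal <e u, e v>, since w - e w is orthogonal to the range of e. *)
Lemma orth_proj_selfadjoint u v : <[e u, v]> = <[u, e v]>.
Proof.
have h w w' : <[w, e w']> = <[e w, e w']>.
  apply/eqP; rewrite -subr_eq0 -innerBl (projV w).2 //; exact: orth_proj_in.
by rewrite h innerC h -innerC.
Qed.

Lemma orth_proj_bounded : bounded_op e.
Proof.
split; first exact: orth_proj_linear.
move=> u; apply/cvgrPdist_lt => eps eps0; near=> w.
rewrite (le_lt_trans (is_proj_le sV (projV u) (projV w))) //; near: w.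
Unshelve. all: by end_near. Qed.

(** As T preserves V and its orthogonal complement, T u = T (e u) + T (u - e u) is the orthogonal
    decomposition of T u. *)
Lemma orth_proj_commute T : bounded_op T ->
  (forall v, V v -> V (T v)) ->
  (forall u, (forall v, V v -> <[u, v]> = 0) ->
    forall v, V v -> <[T u, v]> = 0) ->
  T \o e = e \o T.
Proof.
move=> [lT _] TV TVo; apply/funext => u /=; apply/esym/orth_proj_eq => //.
split; first by apply: TV; exact: orth_proj_in.
move=> w Vw; have -> : T u - T (e u) = T (u - e u).
  by rewrite addrC -scaleN1r -lT scaleN1r addrC.
by apply: TVo => //; apply: (projV u).2.
Qed.

End projection.

(** The projection onto W fixes V, which is the second identity; the first is its adjoint. *)
Lemma orth_proj_sub V W : subspace V -> subspace W ->
  (forall u, is_proj V u (orth_proj V u)) ->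
  (forall u, is_proj W u (orth_proj W u)) -> V `<=` W ->
  orth_proj V \o orth_proj W = orth_proj V /\
  orth_proj W \o orth_proj V = orth_proj V.
Proof.
move=> sV sW pV pW VW; split; apply/funext => u /=; last first.
  by apply: (orth_proj_id sW); apply: VW; exact: orth_proj_in.
apply: inner_inj => v; rewrite !(orth_proj_selfadjoint pV).
rewrite (orth_proj_selfadjoint pW) (orth_proj_id sW) //.
by apply: VW; exact: orth_proj_in.
Qed.

End hilbert.

(** * Bounded operators, bicommutants and von Neumann algebras with a trace *)

Section operators.
Context {R : realType} {H : hilbert R}.
Implicit Types (T S x y : H -> H) (A B : set (H -> H)).
Local Notation "<[ u , v ]>" := (inner H u v).

Lemma combE c T S u : (c *: T + S) u = c *: T u + S u.
Proof. by []. Qed.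

Lemma bounded_op_comb c T S : bounded_op T -> bounded_op S ->
  bounded_op (c *: T + S).
Proof.
move=> [lT cT] [lS cS]; split.
  move=> a u v; rewrite !combE lT lS !scalerDr !scalerA mulrC -!addrA.
  by congr (_ + _); rewrite addrCA.
by move=> u; apply: cvgD; [apply: cvgZl_tmp; exact: cT|exact: cS].
Qed.

Lemma bounded_op_comp T S : bounded_op T -> bounded_op S ->
  bounded_op (T \o S).
Proof.
move=> [lT cT] [lS cS]; split; first by move=> a u v; rewrite /= lS lT.
by move=> u; apply: continuous_comp; [exact: cS|exact: cT].
Qed.

Lemma bounded_op_id : bounded_op (id : H -> H).
Proof. by split => // u; exact: cvg_id. Qed.

Lemma bounded_op0 : bounded_op (0 : H -> H).
Proof.
split; last by move=> u; exact: cvg_cst.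
by move=> a u v; rewrite -[RHS]/(a *: 0 + 0) scaler0 addr0.
Qed.

Lemma bounded_opB T u v : bounded_op T -> T (u - v) = T u - T v.
Proof. by move=> [lT _]; rewrite addrC -scaleN1r lT scaleN1r addrC. Qed.

Lemma comp_comb T c S S' : bounded_op T ->
  T \o (c *: S + S') = c *: (T \o S) + (T \o S').
Proof.
move=> [lT _]; apply/funext => u /=.
by rewrite -[RHS]/(c *: T (S u) + T (S' u)) lT.
Qed.

(** The closure properties of a bicommutant are proved for an arbitrary set [A], so they serve von
    Neumann algebras and also the basic construction, which is a bicommutant by definition. *)
Lemma bicommutant_bounded A T : commutant (commutant A) T -> bounded_op T.
Proof. by case. Qed.

Lemma bicommutant_comb A c T S : commutant (commutant A) T ->
  commutant (commutant A) S -> commutant (commutant A) (c *: T + S).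
Proof.
move=> [bT cT] [bS cS]; split; first exact: bounded_op_comb.
move=> U AU; rewrite comp_comb; last by case: AU.
by rewrite -cT // -cS.
Qed.

Lemma bicommutant_comp A T S : commutant (commutant A) T ->
  commutant (commutant A) S -> commutant (commutant A) (T \o S).
Proof.
move=> [bT cT] [bS cS]; split; first exact: bounded_op_comp.
by move=> U AU; rewrite -compA cS // compA cT // -compA.
Qed.

Lemma bicommutant_id A : commutant (commutant A) id.
Proof. by split; [exact: bounded_op_id|]. Qed.

Lemma bicommutant0 A : commutant (commutant A) 0.
Proof.
split; first exact: bounded_op0.
move=> U [bU _]; apply/funext => u.
have := bounded_opB 0 0 bU; rewrite !subrr => U0.
by rewrite -[RHS]/(U 0) U0.
Qed.

Section vna.
Variable A : set (H -> H).
Hypothesis vA : von_neumann_algebra A.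

Lemma vna_bounded x : A x -> bounded_op x.
Proof. by have [+ _ _] := vA; apply. Qed.

Lemma vna_comb c x y : A x -> A y -> A (c *: x + y).
Proof. by have [_ _ <-] := vA; exact: bicommutant_comb. Qed.

Lemma vnaB x y : A x -> A y -> A (x - y).
Proof. by move=> Ax Ay; rewrite addrC -scaleN1r; exact: vna_comb. Qed.

Lemma vna_comp x y : A x -> A y -> A (x \o y).
Proof. by have [_ _ <-] := vA; exact: bicommutant_comp. Qed.

Lemma vna_id : A id.
Proof. by have [_ _ <-] := vA; exact: bicommutant_id. Qed.

Lemma vna0 : A 0.
Proof. by have [_ _ <-] := vA; exact: bicommutant0. Qed.

Lemma vna_adj x : A x -> A (adj x).
Proof. by have [_ + _] := vA; apply. Qed.

Section trace.
Variable t : (H -> H) -> R[i].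
Hypothesis tA : normalized_trace A t.

Lemma trace0 : t 0 = 0.
Proof.
have [tl _ _ _ _] := tA; have := tl (-1) 0 0 vna0 vna0.
by rewrite scaler0 addr0 mulN1r addNr.
Qed.

Lemma traceC x y : A x -> A y -> t (x \o y) = t (y \o x).
Proof. by have [_ _ _ _ +] := tA; apply. Qed.

(* Faithfulness of the trace replaces the Riesz representation theorem: the
   junk value 0 of [adj x] would give t (x^* x) = 0. *)
Lemma adjP x u v : A x -> <[x u, v]> = <[u, adj x v]>.
Proof.
move=> Ax; have : adj (H := H) x = 0 -> x = 0.
  move=> x0; have [_ _ + _ _] := tA; apply => //.
  by rewrite x0 -[RHS]trace0; congr t.
rewrite /adj; case: xgetP => [S -> [_ xS] _|_ ->//]; first exact: xS.
by rewrite [LHS]linear0l [RHS]linear0r.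
Qed.

Lemma adjK x : A x -> adj (adj x) = x.
Proof.
move=> Ax; apply: adj_eq; first exact: vna_bounded.
by move=> u v; rewrite innerC -adjP // -innerC.
Qed.

Lemma adjM x y : A x -> A y -> adj (x \o y) = adj y \o adj x.
Proof.
move=> Ax Ay; apply: adj_eq; last by move=> u v; rewrite /= !adjP.
by apply: vna_bounded; apply: vna_comp; exact: vna_adj.
Qed.

Lemma adjB x y : A x -> A y -> adj (x - y) = adj x - adj y.
Proof.
move=> Ax Ay; apply: adj_eq => [|u v]; last first.
  rewrite -[(x - y) u]/(x u - y u) -[(adj x - adj y) v]/(adj x v - adj y v).
  by rewrite innerBl innerBr !adjP.
by apply: vna_bounded; apply: vnaB; exact: vna_adj.
Qed.

End trace.
End vna.
End operators.

(** * The space L^2(M), conditional expectations and Jones projections *)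

Section standard_form.
Context {R : realType} {H L : hilbert R}.
Variables (M : set (H -> H)) (tau : (H -> H) -> R[i]).
Hypotheses (vM : von_neumann_algebra M) (htau : normalized_trace M tau).
Variables (j : (H -> H) -> L) (lam : (H -> H) -> (L -> L)).
Hypotheses (hj : L2_space M tau j) (hlam : left_action M j lam).
Implicit Types (x y : H -> H) (P N : set (H -> H)).
Local Notation "<[ u , v ]>" := (inner L u v).

Lemma L2_inner x y : M x -> M y -> <[j x, j y]> = tau (adj y \o x).
Proof. by have [_ + _] := hj; apply. Qed.

Lemma L2B x y : M x -> M y -> j (x - y) = j x - j y.
Proof.
have [jl _ _] := hj; move=> Mx My.
by rewrite addrC -scaleN1r jl // scaleN1r addrC.
Qed.

Lemma L2_inj x y : M x -> M y -> j x = j y -> x = y.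
Proof.
move=> Mx My jxy; apply/eqP; rewrite -subr_eq0; apply/eqP.
have Mxy := vnaB vM Mx My; have [_ _ + _ _] := htau; apply => //.
by rewrite -L2_inner // L2B // jxy subrr [LHS]linear0l.
Qed.

Lemma L2_norm_adj x : M x -> `|j (adj x)| = `|j x|.
Proof.
move=> Mx; have Mx' := vna_adj vM Mx.
apply/eqP; rewrite -(eqrXn2 (n := 2)) // !inner_norm !L2_inner //.
by rewrite (adjK vM htau) // (traceC htau).
Qed.

Lemma L2_subspace P : von_neumann_algebra P -> P `<=` M ->
  subspace (closure (j @` P)).
Proof.
have [jl _ _] := hj; move=> vP PM; apply: closure_subspace; split.
  exists (id - id); first by apply: (vnaB vP); exact: vna_id.
  by rewrite L2B ?subrr //; exact: vna_id.
move=> c _ _ [x Px <-] [y Py <-]; exists (c *: x + y); first exact: vna_comb.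
by rewrite jl //; exact: PM.
Qed.

(** For u = j z both sides are tau (y^* x z); both are continuous in u, and the vectors j z are
    dense. *)
Lemma lam_adj x y u : M x -> M y ->
  <[lam x u, j y]> = <[u, j (adj x \o y)]>.
Proof.
move=> Mx My; have [_ _ jM] := hj; have [[_ lc] lj] := hlam Mx.
apply: (@eq_on_closure _ _ _ (fun u => <[lam x u, j y]>)
  (fun u => <[u, j (adj x \o y)]>) (j @` M)).
- by move=> v; exact: cvg_comp (lc v) (@continuous_inner_l _ L (j y) (lam x v)).
- exact: continuous_inner_l.
- have Mxy : M (adj x \o y) by apply: (vna_comp vM) => //; exact: vna_adj.
  move=> _ [z Mz <-]; rewrite lj // !L2_inner //; last exact: vna_comp.
  by rewrite (adjM vM htau) ?(adjK vM htau) //; exact: vna_adj.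
- by rewrite jM.
Qed.

Section subalgebra.
Variables (P : set (H -> H)) (E : (H -> H) -> (H -> H)).
Hypotheses (vP : von_neumann_algebra P) (PM : P `<=` M).
Hypothesis (hE : conditional_expectation M tau P E).
Local Notation V := (closure (j @` P)).

(** For p in P, tau (p^* E(x)) = tau (E(p^* x)) = tau (p^* x), by the bimodule property and
    preservation of the trace. Orthogonality to j P then passes to the closure. *)
Lemma condexp_is_proj x : M x -> is_proj V (j x) (j (E x)).
Proof.
have [[EP _] _ _ Emod Etau] := hE; move=> Mx.
split; first by apply: subset_closure; exists (E x) => //; exact: EP.
apply: (@eq_on_closure _ _ _ (fun w => <[j x - j (E x), w]>) (fun=> 0)).
- exact: continuous_inner_r.
- exact: cst_continuous.
- move=> _ [p Pp <-]; have Mp := PM Pp; have MEx := PM (EP x Mx).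
  rewrite innerBl !L2_inner // -[X in X - _]Etau; last first.
    by apply: (vna_comp vM) => //; exact: vna_adj.
  rewrite (Emod (adj p) x id) ?subrr //; first exact: vna_adj.
  exact: vna_id.
Qed.

(** The conditional expectation supplies the projection on the dense set j M, and [is_proj_closure]
    extends existence to all of L^2(M). *)
Lemma L2_is_proj u : is_proj V u (orth_proj V u).
Proof.
have sV := L2_subspace vP PM; have [_ _ jM] := hj.
apply: (@is_proj_closure _ _ V (j @` M)) => //; first exact: closed_closure.
  by move=> _ [x Mx <-]; apply: (is_projP sV); exact: condexp_is_proj.
by rewrite jM.
Qed.

Lemma jones_projE x : M x -> jones_proj j P (j x) = j (E x).
Proof.
move=> Mx; apply: orth_proj_eq; first exact: L2_subspace.
exact: condexp_is_proj.
Qed.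

End subalgebra.

(* An operator commuting with [lam M] and e_N is right multiplication by a
   vector xi of L^2(N). It preserves L^2(P), and so does its adjoint, right
   multiplication by the limit eta of the j (n^* ) for j n tending to xi. *)
Lemma jones_proj_basic_construction N P EP : von_neumann_algebra N ->
  von_neumann_algebra P -> N `<=` P -> P `<=` M ->
  conditional_expectation M tau P EP ->
  (forall u, is_proj (closure (j @` N)) u (jones_proj j N u)) ->
  basic_construction M j lam N (jones_proj j P).
Proof.
move=> vN vP NP PM hP pN; have NM := subset_trans NP PM.
have sP := L2_subspace vP PM; have pP := L2_is_proj vP PM hP.
have Mid := vna_id vM; have [_ _ jM] := hj.
split; first exact: orth_proj_bounded.
move=> T [bT cT]; apply/esym.
set xi := T (j id).
have Tj x : M x -> T (j x) = lam x xi.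
  move=> Mx; have [_ lj] := hlam Mx.
  rewrite -[x in LHS]/(x \o id) -lj // -[LHS]/((T \o lam x) (j id)) cT //.
  by left; exists x.
have Nxi : closure (j @` N) xi.
  (* The projection e_N fixes j 1 and commutes with T, so it fixes xi = T (j 1). *)
  have -> : xi = jones_proj j N xi.
    rewrite /xi -[RHS]/((jones_proj j N \o T) (j id)) -cT; last by right.
    rewrite /= [jones_proj j N _](orth_proj_id (L2_subspace vN NM)) //.
    by apply: subset_closure; exists id => //; exact: vna_id.
  exact: (pN _).1.
have lamN p xi' : P p -> closure (j @` N) xi' -> closure (j @` P) (lam p xi').
  move=> Pp; have [[_ lc] lj] := hlam (PM _ Pp).
  apply: closure_preimage => // _ [n Nn <-]; apply: subset_closure.
  exists (p \o n); first by apply: (vna_comp vP) => //; exact: NP.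
  by rewrite lj //; exact: NM.
have [F [FF FN Fxi]] := closure_image_cvg Nxi.
have /cvg_ex [eta Feta] : cvg ((j \o @adj _ H) @ F).
  apply: (@cvg_contraction R[i] _ L L F N j (j \o @adj _ H) xi FF FN _ Fxi)
    => n m Nn Nm /=.
  have [Mn Mm] := (NM _ Nn, NM _ Nm).
  rewrite -!L2B //; try exact: vna_adj.
  by rewrite -(adjB vM htau) // L2_norm_adj //; exact: vnaB.
have Neta : closure (j @` N) eta.
  apply: closed_cvg _ Feta; first exact: closed_closure.
  apply: filterS FN => n Nn; apply: subset_closure; exists (adj n) => //.
  exact: vna_adj.
(* The limit of the identity tau (z^* n) = tau (n z^* ) as j n tends to xi and j (n^* ) to eta. *)
have xi_eta z : M z -> <[xi, j z]> = <[j (adj z), eta]>.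
  move=> Mz; have Mz' := vna_adj vM Mz.
  have h1 := cvg_comp _ _ Fxi (@continuous_inner_l _ L (j z) xi).
  have h2 := cvg_comp _ _ Feta (@continuous_inner_r _ L (j (adj z)) eta).
  apply: (cvg_unique (@norm_hausdorff _ _) h1).
  apply: cvg_trans h2; apply: near_eq_cvg; apply: filterS FN => n /NM Mn /=.
  have Mn' := vna_adj vM Mn.
  by rewrite !L2_inner // (adjK vM htau) // (traceC htau).
(* On u = j x: <x xi, j p> = <xi, j (x^* p)> = <j (p^* x), eta> = <j x, p eta>. *)
have T_adj p u : P p -> <[T u, j p]> = <[u, lam p eta]>.
  move=> Pp; have Mp := PM _ Pp; have Mp' := vna_adj vM Mp; have [_ Tc] := bT.
  apply: (@eq_on_closure _ _ _ (fun u => <[T u, j p]>)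
    (fun u => <[u, lam p eta]>) (j @` M)); last by rewrite jM.
  - by move=> v; exact: cvg_comp (Tc v) (@continuous_inner_l _ L (j p) (T v)).
  - exact: continuous_inner_l.
  - move=> _ [x Mx <-]; have Mx' := vna_adj vM Mx.
    rewrite Tj // lam_adj // xi_eta; last exact: vna_comp.
    rewrite (adjM vM htau) // (adjK vM htau) //.
    by rewrite [RHS]innerC lam_adj // -innerC.
apply: orth_proj_commute => //.
  apply: closure_preimage; first by case: bT.
  by move=> _ [p Pp <-]; rewrite Tj; [exact: lamN|exact: PM].
(* If u is orthogonal to L^2(P), then <T u, j p> = <u, p eta> vanishes because p eta lies in
   L^2(P). *)
move=> u uP; apply: (@eq_on_closure _ _ _ (fun v => <[T u, v]>) (fun=> 0)).
- exact: continuous_inner_r.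
- exact: cst_continuous.
- by move=> _ [p Pp <-]; rewrite T_adj // uP //; exact: lamN.
Qed.

(** If e_P = e_N, any x in P satisfies j x = j (E_N x), so x is in N. This makes the normalisation
    in [unit_vec] meaningful. *)
Lemma jones_proj_neq N P EN EP : von_neumann_algebra N ->
  von_neumann_algebra P -> N `<=` P -> P `<=` M ->
  conditional_expectation M tau N EN -> conditional_expectation M tau P EP ->
  P <> N -> jones_proj j P - jones_proj j N <> 0.
Proof.
move=> vN vP NP PM hN hP PneqN PN0; apply: PneqN; apply/seteqP; split=> // x Px.
have NM := subset_trans NP PM; have Mx := PM _ Px.
have [[ENN _] _ _ _ _] := hN; have [[_ EPP] _ _ _ _] := hP.
suff -> : x = EN x by exact: ENN.
apply: L2_inj => //; first exact: NM _ (ENN _ Mx).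
have : (jones_proj j P - jones_proj j N) (j x) = 0 by rewrite PN0.
rewrite -[LHS]/(jones_proj j P (j x) - jones_proj j N (j x)).
move=> /eqP; rewrite subr_eq0 => /eqP.
by rewrite (jones_projE vP PM hP) // (jones_projE vN NM hN) // EPP.
Qed.

(** The expectations and the projections agree on j M: density gives one direction, injectivity of j
    the other. *)
Lemma commuting_square_jones_proj N P Q EN EP EQ : von_neumann_algebra N ->
  von_neumann_algebra P -> von_neumann_algebra Q ->
  N `<=` M -> P `<=` M -> Q `<=` M ->
  conditional_expectation M tau N EN -> conditional_expectation M tau P EP ->
  conditional_expectation M tau Q EQ ->
  commuting_square M EN EP EQ <->
  jones_proj j Q \o jones_proj j P = jones_proj j N.
Proof.
move=> vN vP vQ NM PM QM hN hP hQ; have [_ _ jM] := hj.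
have pN := L2_is_proj vN NM hN; have pP := L2_is_proj vP PM hP.
have pQ := L2_is_proj vQ QM hQ.
have bounded_proj B : von_neumann_algebra B -> B `<=` M ->
    (forall u, is_proj (closure (j @` B)) u (jones_proj j B u)) ->
    bounded_op (jones_proj j B).
  by move=> vB BM; apply: orth_proj_bounded; exact: L2_subspace.
have [[EPP _] _ _ _ _] := hP; have [[EQQ _] _ _ _ _] := hQ.
have [[ENN _] _ _ _ _] := hN.
have EPM x : M x -> M (EP x) by move=> /EPP/PM.
have EQM x : M x -> M (EQ x) by move=> /EQQ/QM.
have ENM x : M x -> M (EN x) by move=> /ENN/NM.
split=> [sq|QP].
  apply/funext => u; apply: (@eq_on_closure _ _ _ _ _ (j @` M)).
  - have bQ := bounded_proj _ vQ QM pQ; have bP := bounded_proj _ vP PM pP.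
    by have [] := bounded_op_comp bQ bP.
  - by have [] := bounded_proj _ vN NM pN.
  - move=> _ [x Mx <-] /=; rewrite (jones_projE vP PM hP) //.
    rewrite (jones_projE vQ QM hQ); last exact: EPM.
    by rewrite (jones_projE vN NM hN) // (sq x Mx).2.
  - by rewrite jM.
(* Taking adjoints gives the product in the opposite order, as a commuting square asks for both. *)
have PQ : jones_proj j P \o jones_proj j Q = jones_proj j N.
  apply/funext => u; apply: inner_inj => v /=.
  rewrite [LHS](orth_proj_selfadjoint pP) [LHS](orth_proj_selfadjoint pQ).
  rewrite -[X in <[_, X]>]/((jones_proj j Q \o jones_proj j P) v) QP.
  by rewrite [RHS](orth_proj_selfadjoint pN).
move=> x Mx; split; apply: L2_inj; rewrite ?EPM ?EQM ?ENM //.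
- by apply/EPM/EQM.
- by apply: ENM.
- rewrite -(jones_projE vN NM hN) // -PQ /=.
  by rewrite (jones_projE vQ QM hQ) // (jones_projE vP PM hP) //; exact: EQM.
- by apply/EQM/EPM.
- by apply: ENM.
- rewrite -(jones_projE vN NM hN) // -QP /=.
  by rewrite (jones_projE vP PM hP) // (jones_projE vQ QM hQ) //; exact: EPM.
Qed.

End standard_form.

(** * Right angles and traces of products of projections *)

Lemma acos_eq_pihalf {R : realType} (x : R) : acos x = pi / 2 <-> x = 0.
Proof.
split=> [|->]; last exact: acos0.
rewrite unlock; case: xgetP => [y _ [_ <-] ->|_]; first exact: cos_pihalf.
(* When no angle has cosine x, [acos x] is the default value 0, which differs from pi / 2. *)
by move=> /esym/eqP; rewrite gt_eqF // divr_gt0 // pi_gt0.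
Qed.

Lemma Re_mul_real {R : rcfType} (r : R) (z : R[i]) :
  complex.Re (r%:C * z) = r * complex.Re z.
Proof. by case: z => a b /=; rewrite mul0r subr0. Qed.

(** In the order of R[i] a nonnegative element is real. *)
Lemma Re_ge0_eq0 {R : rcfType} (z : R[i]) :
  0 <= z -> complex.Re z = 0 -> z = 0.
Proof. by case: z => a b; rewrite lecE /= => /andP[/eqP -> _] ->. Qed.

Section trace_of_projections.
Context {R : realType} {L : hilbert R}.
Variables (X : set (L -> L)) (tr : (L -> L) -> R[i]).
Local Notation A := (commutant (commutant X)).
Local Notation "<[ u , v ]>" := (inner L u v).
Hypothesis htr : normalized_trace A tr.
Implicit Types p q : L -> L.

(** Stated through the inner product, the form known for projections; [adj_eq] turns it into a value
    of [adj]. *)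
Definition selfadjoint p := forall u v, <[p u, v]> = <[u, p v]>.

Lemma bicommutant_trace0 : tr 0 = 0.
Proof.
have [tl _ _ _ _] := htr; have A0 := bicommutant0 X.
by have := tl (-1) 0 0 A0 A0; rewrite scaler0 addr0 mulN1r addNr.
Qed.

Lemma adj_scale_selfadjoint (r : R) p : A p -> selfadjoint p ->
  adj (r%:C *: p) = r%:C *: p.
Proof.
move=> Ap sp; apply: adj_eq => [|u v].
  rewrite -[_ *: p]addr0; apply: bicommutant_bounded X _ _.
  by apply: bicommutant_comb => //; exact: bicommutant0.
rewrite -[(_ *: p) u]/(r%:C *: p u) -[(_ *: p) v]/(r%:C *: p v).
by rewrite innerZl innerZr sp conjc_real.
Qed.

Lemma trace_projections_eq0 p q : A p -> A q -> p \o p = p -> q \o q = q ->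
  selfadjoint p -> selfadjoint q ->
  complex.Re (tr (q \o p)) = 0 <-> q \o p = 0.
Proof.
move=> Ap Aq pp qq sp sq; split=> [|->]; last by rewrite bicommutant_trace0.
have Aqp := bicommutant_comp Aq Ap.
have qpE : tr (adj (q \o p) \o (q \o p)) = tr (q \o p).
  have -> : adj (q \o p) = p \o q.
    apply: adj_eq => [|u v]; last by rewrite /= sq sp.
    exact: bicommutant_bounded (bicommutant_comp Ap Aq).
  (* Once qq = q has shortened the product, the trace property moves the outer p to the right, where
     pp = p absorbs it. *)
  have -> : (p \o q) \o (q \o p) = p \o (q \o p).
    by rewrite -compA (compA q q p) qq.
  have [_ _ _ _ ->//] := htr.
  by rewrite -compA pp.
have [_ tr_ge0 tr_eq0 _ _] := htr.
by move=> Re0; apply: tr_eq0 => //; apply: Re_ge0_eq0; rewrite ?tr_ge0 // qpE.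
Qed.

Lemma tr_norm_eq0 p : A p -> tr_norm tr p = 0 -> p = 0.
Proof.
move=> Ap; have [_ tr_ge0 tr_eq0 _ _] := htr.
have := tr_ge0 p Ap; rewrite /tr_norm => t0 /eqP; rewrite sqrtr_eq0 => Re0.
(* [Num.sqrt] vanishes on negative numbers too, so positivity of the trace supplies the other
   inequality. *)
apply: tr_eq0 => //; apply: Re_ge0_eq0 => //; apply/eqP.
by rewrite eq_le Re0 /=; move: t0; rewrite lecE => /andP[].
Qed.

Lemma tr_inner_scale (r s : R) p q : A p -> A q -> selfadjoint q ->
  complex.Re (tr_inner tr (r%:C *: p) (s%:C *: q)) =
  s * (r * complex.Re (tr (q \o p))).
Proof.
move=> Ap Aq sq; rewrite /tr_inner adj_scale_selfadjoint //.
have [lq _] := bicommutant_bounded Aq; have [tl _ _ _ _] := htr.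
have A0 := bicommutant0 X.
have Aqp := bicommutant_comp Aq Ap.
have -> : (s%:C *: q) \o (r%:C *: p) = (s%:C * r%:C) *: (q \o p) + 0.
  apply/funext => u; rewrite addr0.
  rewrite -[LHS]/(s%:C *: q (r%:C *: p u)) -[RHS]/((s%:C * r%:C) *: q (p u)).
  have q0 : q 0 = 0.
    by have := bounded_opB 0 0 (bicommutant_bounded Aq); rewrite !subrr.
  by rewrite -[r%:C *: p u]addr0 lq q0 addr0 scalerA.
by rewrite tl // bicommutant_trace0 addr0 -mulrA !Re_mul_real.
Qed.

End trace_of_projections.

(** The terms eg, gf and gg all equal g. The case e = f gives idempotence of e - g; the general case
    relates e_Q e_P to qp. *)
Lemma comp_sub_proj {R : realType} {L : hilbert R} (e f g : L -> L) :
  bounded_op e -> bounded_op g -> e \o g = g -> g \o f = g -> g \o g = g ->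
  (e - g) \o (f - g) = (e \o f) - g.
Proof.
move=> be bg eg gf gg; apply/funext => u.
rewrite -[LHS]/(e (f u - g u) - g (f u - g u)).
rewrite (bounded_opB _ _ be) (bounded_opB _ _ bg).
rewrite -[e (g u)]/((e \o g) u) eg -[g (f u)]/((g \o f) u) gf.
by rewrite -[g (g u)]/((g \o g) u) gg subrr subr0.
Qed.

(** * Commuting squares and right angles between intermediate subfactors *)

Unset Implicit Arguments.

Theorem proposition3p4 (R : realType) (H : hilbert R)
  (N P Q M : set (H -> H))
  (hN : II1_factor N) (hM : II1_factor M)
  (hP : is_factor P) (hQ : is_factor Q)
  (hNP : N `<=` P) (hPM : P `<=` M) (hNQ : N `<=` Q) (hQM : Q `<=` M)
  (hP_neq : P <> N) (hQ_neq : Q <> N)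
  (tau : (H -> H) -> R[i]) (htau : normalized_trace M tau)
  (EN EP EQ : (H -> H) -> (H -> H))
  (hEN : conditional_expectation M tau N EN)
  (hEP : conditional_expectation M tau P EP)
  (hEQ : conditional_expectation M tau Q EQ)
  (L : hilbert R) (j : (H -> H) -> L) (hj : L2_space M tau j)
  (lam : (H -> H) -> (L -> L)) (hlam : left_action M j lam)
  (hindex : finite_index lam N)
  (tr : (L -> L) -> R[i])
  (htr : normalized_trace (basic_construction M j lam N) tr) :
  commuting_square M EN EP EQ <-> angle j tr N P Q = pi / 2.
Proof.
have [[vN _ _] _ _] := hN; have [[vM _ _] _ _] := hM.
have [vP _ _] := hP; have [vQ _ _] := hQ.
have NM := subset_trans hNP hPM.
(* What is used of e_B - e_1 is gathered once, with [B] standing for [P] or [Q]. *)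
have sub_proj B EB : von_neumann_algebra B -> N `<=` B -> B `<=` M ->
    conditional_expectation M tau B EB -> B <> N ->
    let e1 := jones_proj j N in let eB := jones_proj j B in
    let A := basic_construction M j lam N in
    [/\ (bounded_op eB /\ bounded_op e1) /\ (eB \o e1 = e1 /\ e1 \o eB = e1),
        A (eB - e1), (eB - e1) \o (eB - e1) = eB - e1,
        selfadjoint (eB - e1) & tr_norm tr (eB - e1) <> 0].
  move=> vB NB BM hB BneqN e1 eB A.
  have [pN pB] := (L2_is_proj vM hj vN NM hEN, L2_is_proj vM hj vB BM hB).
  have [sN sB] := (L2_subspace vM hj vN NM, L2_subspace vM hj vB BM).
  have sub : closure (j @` N) `<=` closure (j @` B).
    by apply: closureS => _ [x Nx <-]; exists x => //; exact: NB.
  have [e1B eB1] := orth_proj_sub sN sB pN pB sub.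
  have [be1 beB] := (orth_proj_bounded sN pN, orth_proj_bounded sB pB).
  have [e11 _] := orth_proj_sub sN sN pN pN (@subset_refl _ _).
  have [eBB _] := orth_proj_sub sB sB pB pB (@subset_refl _ _).
  have Ae1 : A e1.
    by apply: (jones_proj_basic_construction vM htau hj hlam vN vN _ NM hEN).
  have AeB : A eB.
    by apply: (jones_proj_basic_construction vM htau hj hlam vN vB NB BM hB).
  have AeB1 : A (eB - e1).
    by rewrite addrC -scaleN1r; exact: bicommutant_comb.
  split=> //.
  - by rewrite comp_sub_proj // eBB.
  - move=> u v.
    rewrite -[(eB - e1) u]/(eB u - e1 u) -[(eB - e1) v]/(eB v - e1 v).
    rewrite innerBl innerBr [inner L (eB u) v](orth_proj_selfadjoint pB).
    by rewrite [inner L (e1 u) v](orth_proj_selfadjoint pN).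
  - move=> /(tr_norm_eq0 htr AeB1).
    exact: (jones_proj_neq vM htau hj vN vB NB BM hEN hB BneqN).
have [[[bP b1] [eP1 e1P]] AP iP sP nP] := sub_proj P EP vP hNP hPM hEP hP_neq.
have [[[bQ _] [eQ1 _]] AQ iQ sQ nQ] := sub_proj Q EQ vQ hNQ hQM hEQ hQ_neq.
rewrite (commuting_square_jones_proj vM htau hj vN vP vQ NM hPM hQM
  hEN hEP hEQ).
(* The angle condition becomes s (r Re tr (qp)) = 0, with r and s the inverse norms of p and q. *)
rewrite acos_eq_pihalf /unit_vec (tr_inner_scale htr) //.
have -> : jones_proj j Q \o jones_proj j P = jones_proj j N <->
    (jones_proj j Q - jones_proj j N) \o (jones_proj j P - jones_proj j N) = 0.
  rewrite comp_sub_proj //; last first.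
    have pN := L2_is_proj vM hj vN NM hEN; have sN := L2_subspace vM hj vN NM.
    exact: (orth_proj_sub sN sN pN pN (@subset_refl _ _)).1.
  by split=> [->|/eqP]; [rewrite subrr|rewrite subr_eq0 => /eqP].
rewrite -(trace_projections_eq0 htr) //; split=> [->|]; first by rewrite !mulr0.
(* Both norms are nonzero, so only the trace factor can vanish. *)
move=> /eqP; rewrite !mulf_eq0 !invr_eq0.
by case/or3P=> /eqP.
Qed.
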